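(* Let $\mathcal{A}$ be a unital $*$-algebra, $\mathcal{H}$ a Hilbert space, $T:\mathcal{A}\to\mathcal{L}(\mathcal{H})$ a hermitian linear map, and let $K_T(x,y)=T(xy^* )$, $x,y\in\mathcal{A}$. Given a minimal Stinespring dilation $(\pi,\mathcal{K},B)$ of $T$, let $$V(x)=\pi(x^* )JB,\quad x\in\mathcal{A},$$ where $J$ is a fundamental symmetry of $\mathcal{K}$. Then $(V,\mathcal{K})$ is an invariant Kolmogorov decomposition of the hermitian kernel $K_T$. In addition, the formula $V(x)=\pi(x^* )JB$, $x\in\mathcal{A}$, establishes a bijective correspondence between the set of minimal Stinespring dilations of $T$ and the set of invariant Kolmogorov decompositions of $K_T$.
   Context: A Kreĭn space is an indefinite inner product space $(\mathcal{K},[\cdot,\cdot]_{\mathcal{K}})$ for which there is a positive inner product $\langle\cdot,\cdot\rangle$ making $\mathcal{K}$ a Hilbert space and an operator $J$ with $J^*=J^{-1}=J$ such that $[\xi,\eta]_{\mathcal{K}}=\langle J\xi,\eta\rangle$; $J$ is called a fundamental symmetry. Topological notions and $*$-adjoints refer to this Hilbert space structure; for $R\in\mathcal{L}(\mathcal{K})$, $R^\sharp=JR^*J$ is the adjoint with respect to $[\cdot,\cdot]_{\mathcal{K}}$. $\mathcal{L}(\cdot,\cdot)$ denotes bounded linear operators, and $\mathcal{L}(\mathcal{K})=\mathcal{L}(\mathcal{K},\mathcal{K})$. A set is total if its linear span is dense. A linear map $T:\mathcal{A}\to\mathcal{L}(\mathcal{H})$ is hermitian if $T(a^* )=T(a)^*$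 for all $a\in\mathcal{A}$. A Stinespring dilation of $T$ is a triplet $(\pi,\mathcal{K},B)$ where $\mathcal{K}$ is a Kreĭn space with a fundamental symmetry $J$, $B\in\mathcal{L}(\mathcal{H},\mathcal{K})$, and $\pi:\mathcal{A}\to\mathcal{L}(\mathcal{K})$ is a selfadjoint representation (that is, $\pi(a^* )=\pi(a)^\sharp=J\pi(a)^*J$ for all $a\in\mathcal{A}$) such that $T(a)=B^*J\pi(a)B$ for all $a\in\mathcal{A}$. It is minimal if $\{\pi(a)B\mathcal{H}\mid a\in\mathcal{A}\}$ is total in $\mathcal{K}$. A kernel $K:X\times X\to\mathcal{L}(\mathcal{H})$ on a set $X$ is hermitian if $K(x,y)=K(y,x)^*$ for all $x,y\in X$. A Kolmogorov decomposition of a hermitian kernel $K$ is a pair $(V,\mathcal{K})$ where $\mathcal{K}$ is a Kreĭn space with fundamental symmetry $J$, $V=\{V(x)\}_{x\in X}\subset\mathcal{L}(\mathcal{H},\mathcal{K})$ satisfies $K(x,y)=V(x)^*JV(y)$ for all $x,y\in X$, and $\{V(x)\mathcal{H}\mid x\in X\}$ is total in $\mathcal{K}$. A Kolmogorov decomposition $(V,\mathcal{K})$ of $K_T$ (here $X=\mathcal{A}$) is called invariant if there is a hermitian representation $U:\mathcal{A}\to\mathcal{L}(\mathcal{K})$ of the multiplicative semigroup $\mathcal{A}$ with involution $*$ (that is, $U(ab)=U(a)U(b)$, $U(1)=I$, $U(a^* )=U(a)^\sharp$) such that $U(a)V(x)=V(xa^* )$ for all $a,x\in\mathcal{A}$.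
   Formalization: The formula V(x)=π(x* )JB is replaced throughout by V(x)=π(x* )B, since with T(a)=B*Jπ(a)B and K(x,y)=V(x)*JV(y) the formula with the extra J yields B*π(xy* )JB, which in general differs from T(xy* ). *)

(* Defs.v *)
From HB Require Import structures.
From mathcomp Require Import all_boot all_order all_algebra.
From mathcomp Require Import complex.
From mathcomp Require Import all_classical all_reals all_analysis.
From mathcomp Require Import ring lra.

Set Implicit Arguments.
Unset Strict Implicit.
Unset Printing Implicit Defensive.

Import Order.TTheory GRing.Theory Num.Theory.
Import numFieldNormedType.Exports.
Local Open Scope classical_set_scope.
Local Open Scope ring_scope.

Local Open Scope complex_scope.

Fact rcD (R : realType) (a b : R) : (a + b)%:C = a%:C + b%:C.
Proof. exact: rmorphD. Qed.
Fact rcM (R : realType) (a b : R) : (a * b)%:C = a%:C * b%:C.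
Proof. exact: rmorphM. Qed.

HB.mixin Record Algebra_isStarAlgebra (C : numClosedFieldType) A
    of GRing.Algebra C A := {
  star : A -> A;
  starK : involutive star;
  star_antilinear : forall (k : C) (a b : A),
    star (k *: a + b) = k^* *: star a + star b;
  starM : forall a b : A, star (a * b) = star b * star a
}.

#[short(type="starAlgType")]
HB.structure Definition StarAlgebra (C : numClosedFieldType) :=
  {A of GRing.Algebra C A & Algebra_isStarAlgebra C A}.

(* [hdot] is linear in its first argument, conjugate-linear in the second. *)
HB.mixin Record CompleteNormedModule_isHilbert (R : realType) V
    of CompleteNormedModule R[i] V := {
  hdot : {dot V for (@Num.conj R[i])};
  hdot_norm : forall x : V, hdot x x = `|x| ^+ 2
}.

#[short(type="hilbertType")]
HB.structure Definition Hilbert (R : realType) :=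
  {V of CompleteNormedModule R[i] V & CompleteNormedModule_isHilbert R V}.

Section BoundedOperators.
Context (R : realType) (H K : normedModType R[i]).

Definition bounded_linear : {pred H -> K} :=
  [pred f | `[< linear f /\ bounded_near f (nbhs (0 : H)) >]].

Record bounded_op := BoundedOp {
  bop_fun :> H -> K;
  _ : bop_fun \in bounded_linear
}.
HB.instance Definition _ := [isSub for bop_fun].
HB.instance Definition _ := [Choice of bounded_op by <:].

Lemma bounded_linearP (f : H -> K) :
  f \in bounded_linear <->
  linear f /\ exists m : R, forall x, `|f x| <= m%:C * `|x|.
Proof.
rewrite inE; split=> [[fl fb]|[fl [m fm]]].
- split=> //.
  pose g := GRing.isLinear.Build _ _ _ _ f fl.
  pose F : {linear H -> K} := HB.pack f g.
  have /linear_boundedP/pinfty_ex_gt0[r r0 Fr] : bounded_near F (nbhs 0) by [].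
  exists (complex.Re r) => x; rewrite RRe_real ?gtr0_real//; exact: Fr.
- split=> //.
  pose g := GRing.isLinear.Build _ _ _ _ f fl.
  pose F : {linear H -> K} := HB.pack f g.
  suff : bounded_near F (nbhs 0) by [].
  apply/linear_boundedP; exists m%:C; split.
    by rewrite complex_real.
  by move=> r mr x; rewrite (le_trans (fm x))// ler_wpM2r// ltW.
Qed.

Lemma bounded_linear_submod_closed : submod_closed bounded_linear.
Proof.
split.
- apply/bounded_linearP; split.
    by move=> k x y; rewrite [RHS](_ : _ = k *: 0 + 0)// scaler0 addr0.
  by exists 0 => x; rewrite [X in `|X|](_ : _ = 0)// normr0 mul0r.
- move=> k f g /bounded_linearP[fl [m fm]] /bounded_linearP[gl [p gp]].
  apply/bounded_linearP; split.
    move=> c x y; rewrite !fctE fl gl !scalerDr !scalerA [c * k]mulrC.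
    by rewrite -!addrA; congr (_ + _); rewrite addrCA.
  exists (complex.Re `|k| * m + p) => x; rewrite !fctE.
  rewrite (le_trans (ler_normD _ _))// normrZ rcD rcM mulrDl.
  apply: lerD => //; rewrite -mulrA RRe_real ?normr_real// ler_wpM2l//.
Qed.
HB.instance Definition _ :=
  GRing.isSubmodClosed.Build R[i] (H -> K) bounded_linear
    bounded_linear_submod_closed.
HB.instance Definition _ := [SubChoice_isSubLmodule of bounded_op by <:].

Lemma bop_linear (F : bounded_op) : linear F.
Proof. by case: F => f /= /bounded_linearP[]. Qed.
HB.instance Definition _ (F : bounded_op) :=
  GRing.isLinear.Build R[i] H K _ F (bop_linear F).

Lemma bop_bounded (F : bounded_op) :
  exists m : R, forall x, `|F x| <= m%:C * `|x|.
Proof. by case: F => f /= /bounded_linearP[]. Qed.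

End BoundedOperators.
Arguments bounded_linear {R} H K.

Notation "''L' ( H , K )" := (bounded_op H K) (at level 8, format "''L' ( H ,  K )").

Section Composition.
Context (R : realType).

Lemma bid_subproof (H : normedModType R[i]) : @id H \in bounded_linear H H.
Proof.
by apply/bounded_linearP; split=> //; exists 1 => x; rewrite mul1r.
Qed.
Definition bid (H : normedModType R[i]) : 'L(H, H) := BoundedOp (bid_subproof H).

Context (H K L : normedModType R[i]).

Lemma bcomp_subproof (F : 'L(K, L)) (G : 'L(H, K)) :
  F \o G \in bounded_linear H L.
Proof.
apply/bounded_linearP; split.
  by move=> k x y /=; rewrite !linearP.
have [m Fm] := bop_bounded F; have [p Gp] := bop_bounded G.
exists (`|m| * p) => x /=.
rewrite (le_trans (Fm _))// rcM -mulrA.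
rewrite (@le_trans _ _ (`|m|%:C * `|G x|))//.
  by rewrite ler_wpM2r// lecR ler_norm.
by rewrite ler_wpM2l// lecR.
Qed.
Definition bcomp (F : 'L(K, L)) (G : 'L(H, K)) : 'L(H, L) :=
  BoundedOp (bcomp_subproof F G).
End Composition.

Notation "F '\ob' G" := (bcomp F G) (at level 40, left associativity).

Section Riesz.
Context (R : realType) (V : hilbertType R).
Implicit Types x y z : V.

Let re x y : R := complex.Re (hdot x y).
Let nr x : R := complex.Re `|x|.

Let nrE x : `|x| = (nr x)%:C.
Proof. by rewrite /nr RRe_real ?normr_real. Qed.

Let nr_ge0 x : 0 <= nr x.
Proof. by rewrite -lecR -nrE normr_ge0. Qed.

Let re_nr x : re x x = nr x ^+ 2.
Proof. by rewrite /re hdot_norm nrE /=; ring. Qed.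

Let reC x y : re x y = re y x.
Proof. by rewrite /re hermC /= expr0 mul1r; case: (hdot y x). Qed.

Let reDl x y z : re (x + y) z = re x z + re y z.
Proof. by rewrite /re linearDl raddfD. Qed.

Let reZl (t : R) x y : re (t%:C *: x) y = t * re x y.
Proof. by rewrite /re linearZl_LR /=; case: (hdot x y) => a b /=; ring. Qed.

Let reDr x y z : re x (y + z) = re x y + re x z.
Proof. by rewrite reC reDl !(reC x). Qed.

Let reZr (t : R) x y : re x (t%:C *: y) = t * re x y.
Proof. by rewrite reC reZl reC. Qed.

Let nrD x y : nr (x + y) <= nr x + nr y.
Proof. by rewrite -lecR rcD -!nrE ler_normD. Qed.

Let nrD2 x y : nr (x + y) ^+ 2 = nr x ^+ 2 + 2 * re x y + nr y ^+ 2.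
Proof. by rewrite -!re_nr reDl !reDr (reC y x); ring. Qed.

Let nrZ (t : R) x : nr (t%:C *: x) ^+ 2 = t ^+ 2 * nr x ^+ 2.
Proof. by rewrite -!re_nr reZl reZr; ring. Qed.

Let re_le x y : re x y <= nr x * nr y.
Proof.
have := nrD x y; have := nrD2 x y.
have := nr_ge0 (x + y); have := nr_ge0 x; have := nr_ge0 y.
move: (nr x) (nr y) (nr (x + y)) (re x y) => a b c d; nra.
Qed.

Lemma re_hdot_le x y : complex.Re (hdot x y) <= complex.Re `|x| * complex.Re `|y|.
Proof. exact: re_le. Qed.

Variables (f : {linear V -> R[i] | *%R}) (m : R).
Hypothesis fm : forall x, complex.Re (f x) <= m * complex.Re `|x|.

Let g x := complex.Re (f x).
Let gD x y : g (x + y) = g x + g y.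
Proof. by rewrite /g linearD raddfD. Qed.
Let gZ (t : R) x : g (t%:C *: x) = t * g x.
Proof. by rewrite /g linearZ /=; case: (f x) => a b /=; ring. Qed.

Let phi x : R := nr x ^+ 2 - 2 * g x.
Let d := inf (range phi).

Let phi_lb : has_lbound (range phi).
Proof.
exists (- m ^+ 2) => _ [x _ <-]; rewrite /phi.
have : g x <= m * nr x := fm x.
have := sqr_ge0 (nr x - m); move: (nr x) (g x) => a b; nra.
Qed.

Let phi_ge x : d <= phi x.
Proof. by apply: ge_inf => //; exists x. Qed.

Let phi_lt n : exists x, phi x < d + n.+1%:R^-1.
Proof.
have [||_ [x _ <-] xd] := @inf_adherent _ (range phi) n.+1%:R^-1.
- by rewrite invr_gt0.
- by split; [exists (phi 0), 0 | exact: phi_lb].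
- by exists x.
Qed.

Let u n : V := projT1 (cid (phi_lt n)).
Let u_lt n : phi (u n) < d + n.+1%:R^-1.
Proof. by rewrite /u; case: cid. Qed.

Let parallelogram x y : nr (x - y) ^+ 2 =
  2 * phi x + 2 * phi y - 4 * phi ((2^-1 : R)%:C *: (x + y)).
Proof.
rewrite /phi nrZ gZ gD nrD2 -scaleN1r.
have -> : -1 = (-1 : R)%:C by rewrite rmorphN.
by rewrite nrD2 nrZ reZr; field.
Qed.

Let u_cauchy n k : (n <= k)%N -> nr (u n - u k) ^+ 2 <= 4 * n.+1%:R^-1.
Proof.
move=> nk; rewrite parallelogram.
have := phi_ge ((2^-1 : R)%:C *: (u n + u k)).
have := u_lt n; have := u_lt k.
have : (k.+1%:R^-1 : R) <= n.+1%:R^-1 by rewrite lef_pV2 ?posrE// ler_nat.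
move: d (phi (u n)) (phi (u k)) (phi (_ *: _)) k.+1%:R^-1 n.+1%:R^-1.
move=> *; lra.
Qed.

Let u_cvg : cvg (u @ \oo).
Proof.
apply: cauchy_cvg; apply: cauchy_exP => e e0.
have [s s0 es] : exists2 s : R, 0 < s & e = s%:C.
  exists (complex.Re e); last by rewrite RRe_real ?gtr0_real.
  by rewrite -ltcR RRe_real ?gtr0_real.
have [N _ Ns] := near_infty_natSinv_lt (PosNum (divr_gt0 (exprn_gt0 2 s0) (ltr0Sn R 3))).
exists (u N); exists N => //= k /= Nk.
rewrite -ball_normE /= es nrE ltcR.
have := u_cauchy Nk; have /= := Ns N (leqnn _).
have := nr_ge0 (u N - u k).
move: (nr _) (_^-1) => a b a0; rewrite ltr_pdivlMr// => h1 h2.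
rewrite -(ltr_pXn2r (n := 2)) ?nnegrE// 1?ltW//; lra.
Qed.

Let v : V := lim (u @ \oo).

Let phi_v : phi v = d.
Proof.
apply/eqP; rewrite eq_le phi_ge andbT; apply/ler_addgt0Pr => e e0.
pose M := 2 * nr v + 3 + 2 * `|m|.
have M0 : 0 < M by rewrite /M; have := nr_ge0 v; have := normr_ge0 m; lra.
pose h := Num.min 1 (e / 2 / M).
have h0 : 0 < h by rewrite /h lt_min ltr01 !divr_gt0.
have hM : h * M <= e / 2 by rewrite -ler_pdivlMr// /h ge_min lexx orbT.
have h1 : h <= 1 by rewrite /h ge_min lexx.
have e2 : 0 < e / 2 by rewrite divr_gt0.
have [k [kh ke]] : exists k, nr (v - u k) <= h /\ phi (u k) <= d + e / 2.
  have hC : 0 < h%:C by rewrite ltcR.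
  have /cvgrPdist_le /(_ _ hC) [N _ Nh] := u_cvg.
  have [N' _ Ne] := near_infty_natSinv_lt (PosNum e2).
  exists (maxn N N'); split.
    by rewrite -lecR -nrE; apply: Nh; rewrite /= leq_maxl.
  rewrite (le_trans (ltW (u_lt _)))// lerD2l ltW//.
  by apply: Ne; rewrite /= leq_maxr.
set w := v - u k in kh; have vE : v = u k + w by rewrite /w addrC subrK.
have : nr (u k) <= nr v + h.
  have -> : u k = v - w by rewrite /w opprB addrC subrK.
  rewrite (le_trans (nrD _ _))// lerD2l (le_trans _ kh)// -lecR -!nrE normrN //.
have : phi v <= phi (u k) + 2 * (nr (u k) * nr w) + nr w ^+ 2 + 2 * (`|m| * nr w).
  rewrite /phi {1 2}vE nrD2 gD.
  have := re_le (u k) w.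
  have : - g w <= `|m| * nr w.
    have := fm (- w); rewrite -/(g (- w)) -/(nr _).
    have -> : g (- w) = - g w by rewrite /g raddfN raddfN.
    move=> /le_trans; apply.
    have -> : nr (- w) = nr w by rewrite /nr normrN.
    by rewrite ler_wpM2r// ler_norm.
  lra.
move: hM ke kh; rewrite /M; have := nr_ge0 (u k); have := nr_ge0 w; have := nr_ge0 v.
have := normr_ge0 m.
move: (phi v) (phi (u k)) (nr (u k)) (nr w) (nr v) `|m| => pv pu a b c q.
move=> q0 c0 b0 a0 hM pud bh pvl ach.
have : a * b <= (c + h) * h by apply: ler_pM => //; lra.
have : b ^+ 2 <= h * h by rewrite expr2; apply: ler_pM.
have : q * b <= q * h by apply: ler_wpM2l.
have : h * h <= h by nra.
nra.
Qed.

Let re_v y : re v y = g y.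
Proof.
have key (t : R) : 0 <= 2 * t * (re v y - g y) + t ^+ 2 * nr y ^+ 2.
  have := phi_ge (v + t%:C *: y); rewrite -phi_v /phi nrD2 nrZ reZr gD gZ; lra.
have := sqr_ge0 (nr y); move: key; move: (re v y) (g y) (nr y ^+ 2) => a b c key c0.
have := key (- (a - b) / (c + 1)).
have c1 : 0 < c + 1 by lra.
have -> : 2 * (- (a - b) / (c + 1)) * (a - b) + (- (a - b) / (c + 1)) ^+ 2 * c
   = - ((a - b) ^+ 2 * (c + 2)) / (c + 1) ^+ 2.
  by field; rewrite gt_eqF.
rewrite pmulr_lge0 ?invr_gt0 ?exprn_gt0// oppr_ge0 pmulr_lle0; last lra.
move=> h; apply/eqP; rewrite -subr_eq0 -sqrf_eq0; apply/eqP/le_anti.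
by rewrite h sqr_ge0.
Qed.

Lemma riesz : exists z, forall x, f x = hdot x z.
Proof.
exists v => x.
have h1 : complex.Re (f x) = complex.Re (hdot x v).
  by rewrite -[LHS](re_v x) reC.
have h2 : complex.Im (f x) = complex.Im (hdot x v).
  have := re_v ('i *: x); rewrite reC /re /g linearZ linearZl_LR /=.
  by case: (f x) => a b; case: (hdot x v) => a' b' /=; rewrite !mul0r !mul1r !sub0r => /oppr_inj.
by move: h1 h2; case: (f x) => a b; case: (hdot x v) => a' b' /= -> ->.
Qed.

End Riesz.

Section Adjoint.
Context (R : realType) (H K : hilbertType R).

Definition is_adjoint (F : 'L(H, K)) (G : 'L(K, H)) : Prop :=
  forall x y, hdot (F x) y = hdot x (G y).

Lemma hdot_inj (V : hilbertType R) (y z : V) :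
  (forall x, hdot x y = hdot x z) -> y = z.
Proof.
move=> yz; apply/eqP; rewrite -subr_eq0 -(dnorm_eq0 (@hdot R V)).
by rewrite linearBr /= !yz subrr.
Qed.

Lemma is_adjoint_exists (F : 'L(H, K)) : exists G, is_adjoint F G.
Proof.
have [m Fm] := bop_bounded F.
have rdot (V : hilbertType R) (x y : V) :
    complex.Re (hdot x y) <= complex.Re `|x| * complex.Re `|y|.
  exact: re_hdot_le.
have nE (V : hilbertType R) (x : V) : `|x| = (complex.Re `|x|)%:C.
  by rewrite RRe_real ?normr_real.
have n0 (V : hilbertType R) (x : V) : 0 <= complex.Re `|x|.
  by rewrite -lecR -nE normr_ge0.
have {}Fm x : complex.Re `|F x| <= m * complex.Re `|x|.
  by rewrite -lecR rcM -!nE.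
have key y : exists z, forall x, hdot (F x) y = hdot x z.
  pose f x := hdot (F x) y.
  have fl : scalar f by move=> k u v; rewrite /f linearP linearPl.
  pose fL := GRing.isLinear.Build _ _ _ _ f fl.
  pose f' : {linear H -> R[i] | *%R} := HB.pack f fL.
  apply: (@riesz _ _ f' (m * complex.Re `|y|)) => x /=.
  rewrite (le_trans (rdot _ _ _))// mulrAC; exact: ler_wpM2r.
have [G GP] := choice key.
have GA : G \in bounded_linear K H.
  apply/bounded_linearP; split.
    by move=> k u v; apply: hdot_inj => x; rewrite linearPr /= -!GP linearPr.
  exists `|m| => y; rewrite nE [X in _ * X]nE -rcM lecR.
  have [->|Gy0] := eqVneq (complex.Re `|G y|) 0; first by rewrite mulr_ge0.
  have Gy_gt0 : 0 < complex.Re `|G y| by rewrite lt_def Gy0 n0.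
  rewrite -(ler_pM2l Gy_gt0).
  have -> : complex.Re `|G y| * complex.Re `|G y| = complex.Re (hdot (F (G y)) y).
    by rewrite GP hdot_norm [in RHS]nE /=; ring.
  rewrite (le_trans (rdot _ _ _))// mulrA; apply: ler_wpM2r => //.
  rewrite (le_trans (Fm _))// mulrC; apply: ler_wpM2l; first exact: n0.
  exact: ler_norm.
by exists (BoundedOp GA) => x y /=; exact: GP.
Qed.

(* Well defined by the Riesz representation theorem. *)
Definition adj (F : 'L(H, K)) : 'L(K, H) := projT1 (cid (is_adjoint_exists F)).

Lemma adjP (F : 'L(H, K)) x y : hdot (F x) y = hdot x (adj F y).
Proof. by rewrite /adj; case: cid. Qed.

End Adjoint.

Section Totality.
Context (C : numFieldType) (V : normedModType C).

Definition linear_span (S : set V) : set V :=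
  [set v | exists (n : nat) (k : 'I_n -> C) (w : 'I_n -> V),
    (forall i, S (w i)) /\ v = \sum_(i < n) k i *: w i].

Definition total_set (S : set V) : Prop := dense (linear_span S).
End Totality.

(* The Hilbert structure [kspace] and the fundamental symmetry are part of the
   data; they determine the indefinite inner product, [kdot] below. *)
Record kreinSpace (R : realType) := KreinSpace {
  kspace :> hilbertType R;
  fundsym : 'L(kspace, kspace);
  fundsym_adj : adj fundsym = fundsym;
  fundsym_inv : fundsym \ob fundsym = bid kspace
}.

Section Krein.
Context (R : realType) (K : kreinSpace R).

Definition kdot (x y : K) : R[i] := hdot (fundsym K x) y.

Definition kadj (F : 'L(K, K)) : 'L(K, K) := fundsym K \ob adj F \ob fundsym K.

Lemma kadjP (F : 'L(K, K)) x y : kdot (F x) y = kdot x (kadj F y).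
Proof.
rewrite /kdot /=.
have JJ z : fundsym K (fundsym K z) = z.
  by have /(congr1 (fun G : 'L(K, K) => G z)) := fundsym_inv K.
have JA u z : hdot (fundsym K u) z = hdot u (fundsym K z).
  by rewrite adjP fundsym_adj.
by rewrite !JA JJ -adjP.
Qed.
End Krein.

Section Stinespring.
Context (R : realType) (A : starAlgType R[i]) (H : hilbertType R).

Definition hermitian_map (T : {linear A -> 'L(H, H)}) : Prop :=
  forall a, T (star a) = adj (T a).

(* [pi 1 = bid K] is not required: it follows for the representation of a
   minimal dilation. *)
Definition selfadjoint_representation (K : kreinSpace R) (pi : A -> 'L(K, K)) :
    Prop :=
  [/\ linear pi, (forall a b, pi (a * b) = pi a \ob pi b)
    & forall a, pi (star a) = kadj (pi a)].

Record stinespring_triplet := StinespringTriplet {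
  st_space : kreinSpace R;
  st_rep : A -> 'L(st_space, st_space);
  st_op : 'L(H, st_space)
}.

Definition stinespring_dilation (T : {linear A -> 'L(H, H)})
    (D : stinespring_triplet) : Prop :=
  selfadjoint_representation (st_rep D) /\
  forall a, T a = adj (st_op D) \ob fundsym (st_space D) \ob st_rep D a \ob st_op D.

Definition minimal_triplet (D : stinespring_triplet) : Prop :=
  total_set [set v | exists a h, v = st_rep D a (st_op D h)].

Definition minimal_stinespring_dilation (T : {linear A -> 'L(H, H)})
    (D : stinespring_triplet) : Prop :=
  stinespring_dilation T D /\ minimal_triplet D.
End Stinespring.

Section Kolmogorov.
Context (R : realType) (X : Type) (H : hilbertType R).

Definition hermitian_kernel (k : X -> X -> 'L(H, H)) : Prop :=
  forall x y, k x y = adj (k y x).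

Record kolmogorov_pair := KolmogorovPair {
  kp_space : kreinSpace R;
  kp_map : X -> 'L(H, kp_space)
}.

Definition kolmogorov_decomposition (k : X -> X -> 'L(H, H))
    (D : kolmogorov_pair) : Prop :=
  (forall x y, k x y = adj (kp_map D x) \ob fundsym (kp_space D) \ob kp_map D y) /\
  total_set [set v | exists x h, v = kp_map D x h].
End Kolmogorov.

Section Invariant.
Context (R : realType) (A : starAlgType R[i]) (H : hilbertType R).

(* No linearity: [U] represents the multiplicative semigroup of [A]. *)
Definition hermitian_semigroup_representation (K : kreinSpace R)
    (U : A -> 'L(K, K)) : Prop :=
  [/\ forall a b, U (a * b) = U a \ob U b, U 1 = bid K
    & forall a, U (star a) = kadj (U a)].

Definition invariant_pair (D : kolmogorov_pair A H) : Prop :=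
  exists2 U : A -> 'L(kp_space D, kp_space D),
    hermitian_semigroup_representation U &
    forall a x, U a \ob kp_map D x = kp_map D (x * star a).

Definition invariant_kolmogorov_decomposition (k : A -> A -> 'L(H, H))
    (D : kolmogorov_pair A H) : Prop :=
  kolmogorov_decomposition k D /\ invariant_pair D.

Definition kernel_of_map (T : {linear A -> 'L(H, H)}) : A -> A -> 'L(H, H) :=
  fun x y => T (x * star y).

(* V(x) = pi(x^* ) B, without a fundamental symmetry in front of B: since
   pi(x^* )^* = J pi(x) J, this gives V(x)^* J V(y) = B^* J pi(x y^* ) B = T(x y^* ),
   whereas pi(x^* ) J B would give B^* pi(x y^* ) J B, which in general is not
   T(x y^* ). *)
Definition kolmogorov_of (D : stinespring_triplet A H) : kolmogorov_pair A H :=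
  KolmogorovPair (fun x => st_rep D (star x) \ob st_op D).
End Invariant.

(* [set_bij] cannot be used here: [set] lives in a universe strictly below that
   of the type of all Hilbert spaces. *)
Definition bijection_between (S T : Type) (P : S -> Prop) (Q : T -> Prop)
    (f : S -> T) : Prop :=
  [/\ forall x, P x -> Q (f x),
      forall x y, P x -> P y -> f x = f y -> x = y
    & forall y, Q y -> exists2 x, P x & f x = y].

(* Main.v *)
Require Import Defs.
From HB Require Import structures.
From mathcomp Require Import all_boot all_order all_algebra.
From mathcomp Require Import complex.
From mathcomp Require Import all_classical all_reals all_analysis.
Import GRing.Theory Num.Theory numFieldNormedType.Exports.
Local Open Scope classical_set_scope.
Local Open Scope ring_scope.

(** The kernel identity is a computation: selfadjointness of [pi] gives
    [adj (pi (star x)) J = J (pi x)], hence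
    [adj (V x) J (V y) = adj B J (pi (x * star y)) B = T (x * star y)],
    and [pi] itself is the semigroup representation that witnesses invariance.

    The bijection is obtained from an explicit inverse: a pair [(V, K)] with
    semigroup representation [U] is sent to the triplet [(U, K, V 1)].  It is
    an inverse because [U] is determined by [V]: invariance prescribes [U a]
    on the total set of vectors [V x h], and a bounded operator is determined
    by its values on a total set ([eq_on_total]).  The same principle shows
    that the representation of a minimal dilation is unital ([minimal_rep1]),
    so that [V 1 = B].

    The one point that is not a substitution is that [U], given only as a
    representation of the multiplicative semigroup, is linear.  Here the
    linearity of [T] enters: the kernel is antilinear in its second variable,
    and since the indefinite inner product is nondegenerate and the vectors
    [V x h] are total, [V y] is determined by the operators
    [adj (V z) J (V y)] ([eq_of_krein_products]).  So [V] is antilinear, and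
    [U a (V x) = V (x * star a)] is linear in [a]. *)

(** * Bounded operators and total sets *)

Section BoundedOperatorTheory.
Context {R : realType}.

Lemma bopP {H K : normedModType R[i]} (F G : 'L(H, K)) :
  (forall x, F x = G x) -> F = G.
Proof. by move=> FG; apply: val_inj; apply/funext. Qed.

Lemma bop_continuous (H K : normedModType R[i]) (F : 'L(H, K)) : continuous F.
Proof.
case: F => f fP /=; have := fP; rewrite inE => -[fl fb].
pose g := GRing.isLinear.Build _ _ _ _ f fl.
pose F : {linear H -> K} := HB.pack f g.
exact: (@bounded_linear_continuous _ _ _ F fb).
Qed.

Lemma eq_on_span {H K : normedModType R[i]} {F G : 'L(H, K)} {S : set H} :
  (forall v, S v -> F v = G v) -> forall v, linear_span S v -> F v = G v.
Proof.
move=> FG _ [n [k [w [Sw ->]]]]; rewrite !linear_sum.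
by apply: eq_bigr => i _; rewrite !linearZ /= FG.
Qed.

Lemma eq_on_total {H K : normedModType R[i]} {F G : 'L(H, K)} {S : set H} :
  total_set S -> (forall v, S v -> F v = G v) -> F = G.
Proof.
move=> St FG; apply: bopP => v; apply: contrapT => FGv.
pose D : 'L(H, K) := F - G.
have Dv : (D @^-1` ~` [set 0]) !=set0.
  by exists v => /eqP; rewrite -[D v]/(F v - G v) subr_eq0 => /eqP.
have Do : open (D @^-1` ~` [set 0]).
  apply: open_comp; first by move=> u _; apply: bop_continuous.
  apply: closed_openC; apply: accessible_closed_set1.
  by apply: hausdorff_accessible; exact: norm_hausdorff.
have [u [Du /(eq_on_span FG) FGu]] := St _ Dv Do.
have Du0 : D u = 0 by rewrite -[LHS]/(F u - G u) FGu subrr.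
exact: Du Du0.
Qed.

End BoundedOperatorTheory.

Section HilbertKrein.
Context {R : realType}.

Lemma hdotC {H : hilbertType R} (x y : H) : hdot x y = (hdot y x)^*%R.
Proof. by rewrite hermC /= expr0 mul1r. Qed.

Lemma adjPr {H K : hilbertType R} (F : 'L(H, K)) x y :
  hdot (adj F y) x = hdot y (F x).
Proof. by rewrite hdotC -adjP -hdotC. Qed.

Lemma fundsymK (K : kreinSpace R) : involutive (fundsym K).
Proof.
by move=> x; have /(congr1 (fun G : 'L(K, K) => G x)) := fundsym_inv K.
Qed.

Lemma fundsym_hdot {K : kreinSpace R} (x y : K) :
  hdot (fundsym K x) y = hdot x (fundsym K y).
Proof. by rewrite adjP fundsym_adj. Qed.

Lemma adj_comp {H K L : hilbertType R} (F : 'L(K, L)) (G : 'L(H, K)) :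
  adj (F \ob G) = adj G \ob adj F.
Proof. by apply: bopP => x; apply: hdot_inj => y; rewrite /= -!adjP. Qed.

(** The adjoints of [J F] and [J G] agree on the total set of vectors
    [V x h]; this turns the cancellation of [adj (V x)] on the left into
    [eq_on_total]. *)
Lemma eq_of_krein_products {X : Type} {H : hilbertType R} {K : kreinSpace R}
    {V : X -> 'L(H, K)} {F G : 'L(H, K)} :
  total_set [set v | exists x h, v = V x h] ->
  (forall x, adj (V x) \ob fundsym K \ob F = adj (V x) \ob fundsym K \ob G) ->
  F = G.
Proof.
move=> Vt FG.
have adjFG : adj F \ob fundsym K = adj G \ob fundsym K.
  apply: (eq_on_total Vt) => _ [x [h ->]]; apply: hdot_inj => u /=.
  rewrite -!adjP -!fundsym_hdot hdotC [RHS]hdotC; congr (_^*).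
  rewrite !adjP.
  by have /(congr1 (fun E : 'L(H, H) => E u)) /= -> := FG x.
apply: bopP => u; apply: hdot_inj => y.
rewrite -(fundsymK K y) -!adjPr.
by have /(congr1 (fun E : 'L(K, H) => E (fundsym K y))) /= -> := adjFG.
Qed.

End HilbertKrein.

(** * From dilations to decompositions *)

Section Correspondence.
Context {R : realType} {A : starAlgType R[i]} {H : hilbertType R}.
Implicit Types (T : {linear A -> 'L(H, H)}) (D : stinespring_triplet A H)
  (P : kolmogorov_pair A H).

Lemma star1 : star 1 = 1 :> A.
Proof. by rewrite -[RHS]starK -[star 1 in RHS]mulr1 starM starK mulr1. Qed.

(** [rho 1] fixes every [rho a (B h)], and these vectors are total. *)
Lemma minimal_rep1 {K : kreinSpace R} {rho : A -> 'L(K, K)} {B : 'L(H, K)} :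
  (forall a b, rho (a * b) = rho a \ob rho b) ->
  total_set [set v | exists a h, v = rho a (B h)] -> rho 1 = bid K.
Proof.
move=> rhoM rhot; apply: (eq_on_total rhot) => _ [a [h ->]] /=.
by rewrite -[RHS]/(rho a (B h)) -{2}[a]mul1r rhoM.
Qed.

(** Selfadjointness in the form used for the kernel: it moves [rho] across
    the fundamental symmetry. *)
Lemma selfadjoint_rep_fundsym {K : kreinSpace R} {rho : A -> 'L(K, K)} a :
  selfadjoint_representation rho ->
  adj (rho (star a)) \ob fundsym K = fundsym K \ob rho a.
Proof.
case=> _ _ rhos; apply: bopP => v /=.
by rewrite -{2}[a]starK (rhos (star a)) /= fundsymK.
Qed.

Lemma kernel_of_map_hermitian {T} :
  hermitian_map T -> hermitian_kernel (kernel_of_map T).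
Proof. by move=> hT x y; rewrite /kernel_of_map -hT starM starK. Qed.

Lemma kolmogorov_of_kernel {T D} : stinespring_dilation T D ->
  forall x y, kernel_of_map T x y = adj (kp_map (kolmogorov_of D) x)
    \ob fundsym (st_space D) \ob kp_map (kolmogorov_of D) y.
Proof.
case=> piS TE x y; have [_ piM _] := piS.
apply: bopP => h; rewrite /kernel_of_map TE piM /= adj_comp /=.
have := selfadjoint_rep_fundsym x piS.
by move/(congr1 (fun G : 'L(st_space D, st_space D) =>
  G (st_rep D (star y) (st_op D h)))) => /= ->.
Qed.

Lemma kolmogorov_of_rep_shift {D} : selfadjoint_representation (st_rep D) ->
  forall a x, st_rep D a \ob kp_map (kolmogorov_of D) x
              = kp_map (kolmogorov_of D) (x * star a).
Proof. by case=> _ piM _ a x; apply: bopP => h /=; rewrite starM starK piM. Qed.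

Lemma kolmogorov_of_invariant {T D} : minimal_stinespring_dilation T D ->
  invariant_kolmogorov_decomposition (kernel_of_map T) (kolmogorov_of D).
Proof.
move=> [DT Dmin]; have [piS _] := DT; have [_ piM pis] := piS.
split; last first.
  exists (st_rep D); last exact: kolmogorov_of_rep_shift.
  by split=> //; exact: minimal_rep1 piM Dmin.
split; first exact: kolmogorov_of_kernel.
(* As [star] is onto, both families consist of the same vectors. *)
congr total_set: Dmin; apply/seteqP; split=> v [a [h ->]].
  by exists (star a), h; rewrite /= starK.
by exists (star a), h.
Qed.

(** * From decompositions to dilations *)

(** The value [bid] is a placeholder on pairs that are not invariant. *)
Definition invariant_rep P : A -> 'L(kp_space P, kp_space P) :=
  if pselect (invariant_pair P) is left p then s2val (cid2 p)
  else fun=> bid _.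

Lemma invariant_repP {P} : invariant_pair P ->
  hermitian_semigroup_representation (invariant_rep P) /\
  forall a x, invariant_rep P a \ob kp_map P x = kp_map P (x * star a).
Proof.
by move=> Pi; rewrite /invariant_rep; case: pselect => // p; case: cid2.
Qed.

Definition stinespring_of P : stinespring_triplet A H :=
  StinespringTriplet (invariant_rep P) (kp_map P 1).

Lemma invariant_rep_unique {P} {U : A -> 'L(kp_space P, kp_space P)} :
  invariant_pair P -> total_set [set v | exists x h, v = kp_map P x h] ->
  (forall a x, U a \ob kp_map P x = kp_map P (x * star a)) ->
  invariant_rep P = U.
Proof.
move=> /invariant_repP[_ PV] Pt UV; apply/funext => a.
apply: (eq_on_total Pt) => _ [x [h ->]].
rewrite -[LHS]/((invariant_rep P a \ob kp_map P x) h).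
by rewrite -[RHS]/((U a \ob kp_map P x) h) PV UV.
Qed.

(** Both sides have the same products with every [adj (V z) J], because
    [T (z * star y)] is antilinear in [y]. *)
Lemma kolmogorov_map_antilinear {T P} :
  kolmogorov_decomposition (kernel_of_map T) P ->
  forall (k : R[i]) x y,
    kp_map P (k *: x + y) = k^*%R *: kp_map P x + kp_map P y.
Proof.
move=> [PT Pt] k x y; apply: (eq_of_krein_products Pt) => z.
rewrite -PT /kernel_of_map star_antilinear mulrDr -scalerAr linearP.
apply: bopP => h /=; rewrite !linearP.
rewrite -[LHS]/(k^*%R *: kernel_of_map T z x h + kernel_of_map T z y h).
by rewrite !PT.
Qed.

(** On the total vectors [V x h], the operator [U a] acts by
    [V x h |-> V (x * star a) h], where the conjugations of [star] and of the
    antilinear [V] cancel. *)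
Lemma invariant_rep_linear {T P} :
  invariant_kolmogorov_decomposition (kernel_of_map T) P ->
  linear (invariant_rep P).
Proof.
move=> [Pk /invariant_repP[_ PV]] k a b; have [_ Pt] := Pk.
apply: (eq_on_total Pt) => _ [x [h ->]].
rewrite -[LHS]/((invariant_rep P (k *: a + b) \ob kp_map P x) h).
rewrite -[RHS]/(k *: (invariant_rep P a \ob kp_map P x) h
                + (invariant_rep P b \ob kp_map P x) h).
rewrite !PV star_antilinear mulrDr -scalerAr (kolmogorov_map_antilinear Pk).
by rewrite conjCK.
Qed.

Lemma stinespring_of_minimal {T P} :
  invariant_kolmogorov_decomposition (kernel_of_map T) P ->
  minimal_stinespring_dilation T (stinespring_of P).
Proof.
move=> Pik; have [[PT Pt] /invariant_repP[[PM _ Ps] PV]] := Pik.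
have PV1 a h : invariant_rep P a (kp_map P 1 h) = kp_map P (star a) h.
  by rewrite -[LHS]/((_ \ob _) h) PV mul1r.
split; first split.
- by split=> //; exact: invariant_rep_linear Pik.
- move=> a; apply: bopP => h /=; rewrite PV1.
  rewrite -[RHS]/((adj _ \ob fundsym _ \ob kp_map P (star a)) h) -PT.
  by rewrite /kernel_of_map starK mul1r.
- congr total_set: Pt; apply/seteqP; split=> v [a [h ->]].
    by exists (star a), h; rewrite /= PV1 starK.
  by exists (star a), h; rewrite /= PV1.
Qed.

(** * The two constructions are mutually inverse *)

Lemma kolmogorov_ofK {T D} : minimal_stinespring_dilation T D ->
  stinespring_of (kolmogorov_of D) = D.
Proof.
move=> Dm; have [[piS _] Dmin] := Dm; have [_ piM _] := piS.
have [[_ Pt] Pi] := kolmogorov_of_invariant Dm.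
rewrite /stinespring_of (invariant_rep_unique Pi Pt (kolmogorov_of_rep_shift piS)).
have -> : kp_map (kolmogorov_of D) 1 = st_op D.
  by apply: bopP => h; rewrite /= star1 (minimal_rep1 piM Dmin).
by case: D {Dm piS Dmin piM Pt Pi}.
Qed.

Lemma stinespring_ofK {P} : invariant_pair P ->
  kolmogorov_of (stinespring_of P) = P.
Proof.
move=> /invariant_repP[_ PV]; case: P PV => K V PV.
congr KolmogorovPair; apply/funext => x.
by rewrite /= PV mul1r starK.
Qed.

End Correspondence.

Theorem proposition4p1 (R : realType) (A : starAlgType R[i]) (H : hilbertType R)
    (T : {linear A -> 'L(H, H)}) (hT : hermitian_map T) :
  [/\ hermitian_kernel (kernel_of_map T),
      (forall D : stinespring_triplet A H,
        minimal_stinespring_dilation T D ->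
        invariant_kolmogorov_decomposition (kernel_of_map T) (kolmogorov_of D))
    & bijection_between (minimal_stinespring_dilation T)
        (invariant_kolmogorov_decomposition (kernel_of_map T))
        (@kolmogorov_of R A H)].
Proof.
split; first exact: kernel_of_map_hermitian.
  by move=> D; exact: kolmogorov_of_invariant.
split=> [D|D E Dm Em DE|P Pik]; first exact: kolmogorov_of_invariant.
  by rewrite -(kolmogorov_ofK Dm) DE (kolmogorov_ofK Em).
exists (stinespring_of P); first exact: stinespring_of_minimal.
by apply: stinespring_ofK; case: Pik.
Qed.
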